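(* Let $H$ and $K$ be infinite-dimensional Hilbert spaces, and let $\mathcal{U}$ be a countably incomplete ultrafilter on an index set $I$. Then the canonical map $\psi_0 : (H)_{\mathcal{U}} \widehat{\otimes} (K)_{\mathcal{U}} \to (H\widehat{\otimes} K)_{\mathcal{U}}$ does not have dense range.
   Context: For a Banach space $E$ and an ultrafilter $\mathcal{U}$ on a set $I$, the ultrapower is $(E)_{\mathcal{U}} = \ell^\infty(E,I)/\{(x_i)_{i\in I} : \lim_{i\to\mathcal{U}}\|x_i\|=0\}$, with norm $\|(x_i)\|=\lim_{i\to\mathcal{U}}\|x_i\|$. An ultrafilter $\mathcal{U}$ is countably incomplete if there is a sequence $U_1\supseteq U_2\supseteq\cdots$ in $\mathcal{U}$ with $\bigcap_n U_n=\emptyset$. $E\widehat{\otimes}F$ denotes the completed projective tensor product of Banach spaces. For Banach spaces $E,F$, $\psi_0:(E)_{\mathcal{U}}\widehat{\otimes}(F)_{\mathcal{U}}\to(E\widehat{\otimes}F)_{\mathcal{U}}$ is the norm-decreasing linear map determined by $\psi_0((x_i)\otimes(y_i))=(x_i\otimes y_i)$. *)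

(* Defs.v *)
From HB Require Import structures.
From mathcomp Require Import all_boot all_order all_algebra generic_quotient.
From mathcomp Require Import all_classical all_reals all_analysis.
From mathcomp Require Import complex ring lra.
Set Implicit Arguments.
Unset Strict Implicit.
Unset Printing Implicit Defensive.
Import Order.TTheory GRing.Theory Num.Theory.
Import numFieldNormedType.Exports.
Local Open Scope classical_set_scope.
Local Open Scope ring_scope.
Local Open Scope quotient_scope.

(* Banach spaces may be real or complex: the scalar field is R or R[i]. *)
Inductive scalar_kind := real_scalars | complex_scalars.

Section scalars.
Variables (R : realType) (k : scalar_kind).

Definition scalar_field : numFieldType :=
  match k with real_scalars => R : numFieldType | complex_scalars => R[i] end.

Definition re_scalar : scalar_field -> R :=
  match k as k' return (match k' with real_scalars => R : numFieldType
                        | complex_scalars => R[i] end) -> R with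
  | real_scalars => id
  | complex_scalars => @complex.Re R
  end.

Definition of_real : R -> scalar_field :=
  match k as k' return R -> (match k' with real_scalars => R : numFieldType
                             | complex_scalars => R[i] end) with
  | real_scalars => id
  | complex_scalars => fun r => (r%:C)%C
  end.

Definition conj_scalar : scalar_field -> scalar_field :=
  match k as k' return (match k' with real_scalars => R : numFieldType
                        | complex_scalars => R[i] end) ->
                       (match k' with real_scalars => R : numFieldType
                        | complex_scalars => R[i] end) with
  | real_scalars => id
  | complex_scalars => @conjc R
  end.

End scalars.

Section scalars_theory.
Variables (R : realType) (k : scalar_kind).
Local Notation K := (scalar_field R k).
Local Notation re := (@re_scalar R k).
Local Notation ofR := (@of_real R k).

Lemma re_scalarD (a b : K) : re (a + b) = re a + re b.
Proof. by move: a b; case: k => //= -[? ?] [? ?]. Qed.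

Lemma of_realK r : re (ofR r) = r.
Proof. by case: k. Qed.

Lemma of_realD r s : ofR (r + s) = ofR r + ofR s.
Proof. by case: k => //=; rewrite rmorphD. Qed.

Lemma of_realM r s : ofR (r * s) = ofR r * ofR s.
Proof. by case: k => //=; rewrite rmorphM. Qed.

Lemma of_real0 : ofR 0 = 0.
Proof. by case: k => //=; rewrite rmorph0. Qed.

Lemma of_real1 : ofR 1 = 1.
Proof. by case: k. Qed.

Lemma ler_of_real r s : (ofR r <= ofR s) = (r <= s).
Proof. by case: k => //=; rewrite lecR. Qed.

Lemma ltr_of_real r s : (ofR r < ofR s) = (r < s).
Proof. by case: k => //=; rewrite ltcR. Qed.

Lemma re_scalarK (a : K) : 0 <= a -> ofR (re a) = a.
Proof.
by move: a; case: k => //= -[x y]; rewrite lecE /= => /andP[/eqP -> _].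
Qed.

Lemma ler_re_scalar (a b : K) : a <= b -> re a <= re b.
Proof. by move: a b; case: k => //= -[? ?] [? ?]; rewrite lecE => /andP[]. Qed.

Lemma re_scalar_ge0 (a : K) : 0 <= a -> 0 <= re a.
Proof. by move: a; case: k => //= -[? ?]; rewrite lecE => /andP[]. Qed.

Lemma re_scalar_gt0 (a : K) : 0 < a -> 0 < re a.
Proof. by move: a; case: k => //= -[? ?]; rewrite ltcE => /andP[]. Qed.

Lemma of_real_normr r : `|ofR r| = ofR `|r|.
Proof.
have [r0|r0] := leP 0 r.
  by rewrite !ger0_norm// -of_real0 ler_of_real.
rewrite (ltr0_norm r0) ltr0_norm -?of_real0 ?ltr_of_real//.
by apply/esym/eqP; rewrite -addr_eq0 -of_realD addNr of_real0.
Qed.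

End scalars_theory.

Section rnorm.
Variables (R : realType) (k : scalar_kind).
Local Notation K := (scalar_field R k).

Definition rabs (a : K) : R := re_scalar `|a|.

Definition rnorm (V : normedModType K) (x : V) : R := re_scalar `|x|.

Lemma of_real_rabs (a : K) : of_real k (rabs a) = `|a|.
Proof. exact: re_scalarK. Qed.

Lemma of_real_inj : injective (@of_real R k).
Proof. exact: can_inj (@of_realK R k). Qed.

Lemma rabs_ge0 (a : K) : 0 <= rabs a.
Proof. exact/re_scalar_ge0. Qed.

Lemma rabs0 : rabs 0 = 0.
Proof. by apply: of_real_inj; rewrite of_real_rabs normr0 of_real0. Qed.

Lemma rabsN1 : rabs (-1) = 1.
Proof. by apply: of_real_inj; rewrite of_real_rabs normrN1 of_real1. Qed.

Lemma rabs_eq0 (a : K) : rabs a = 0 -> a = 0.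
Proof.
by move=> /(congr1 (of_real k)); rewrite of_real_rabs of_real0 => /normr0_eq0.
Qed.

Lemma rabsM (a b : K) : rabs (a * b) = rabs a * rabs b.
Proof. by apply: of_real_inj; rewrite of_realM !of_real_rabs normrM. Qed.

Variable V : normedModType K.
Implicit Types x y : V.

Lemma of_real_rnorm x : of_real k (rnorm x) = `|x|.
Proof. exact: re_scalarK. Qed.

Lemma rnorm_ge0 x : 0 <= rnorm x.
Proof. exact/re_scalar_ge0. Qed.

Lemma rnormD x y : rnorm (x + y) <= rnorm x + rnorm y.
Proof. by rewrite /rnorm -re_scalarD ler_re_scalar// ler_normD. Qed.

Lemma rnormZ (a : K) x : rnorm (a *: x) = rabs a * rnorm x.
Proof.
by apply: of_real_inj; rewrite of_realM of_real_rabs !of_real_rnorm normrZ.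
Qed.

Lemma rnorm_eq0 x : rnorm x = 0 -> x = 0.
Proof.
by move=> /(congr1 (of_real k)); rewrite of_real_rnorm of_real0 => /normr0_eq0.
Qed.
End rnorm.

Record seminorm (R : realType) (k : scalar_kind) (V : lmodType (scalar_field R k)) :=
  Seminorm {
    seminorm_fun :> V -> R;
    seminormD : forall x y, seminorm_fun (x + y) <= seminorm_fun x + seminorm_fun y;
    seminormZ : forall a x, seminorm_fun (a *: x) = rabs a * seminorm_fun x }.

Section separated_quotient.
Variables (R : realType) (k : scalar_kind) (V : lmodType (scalar_field R k)).
Variable p : seminorm V.
Local Notation K := (scalar_field R k).
Implicit Types x y : V.

Lemma seminorm0 : p 0 = 0.
Proof. by rewrite -(scale0r 0) seminormZ rabs0 mul0r. Qed.

Lemma seminormN x : p (- x) = p x.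
Proof. by rewrite -scaleN1r seminormZ rabsN1 mul1r. Qed.

Lemma seminormB x y : p (x - y) <= p x + p y.
Proof. by rewrite -(seminormN y) seminormD. Qed.

Lemma seminorm_distC x y : p (x - y) = p (y - x).
Proof. by rewrite -seminormN opprB. Qed.

Lemma seminorm_ge0 x : 0 <= p x.
Proof. by have := seminormB x x; rewrite subrr seminorm0 -mulr2n pmulrn_lge0. Qed.

Lemma ler_dist_seminorm x y : `|p x - p y| <= p (x - y).
Proof.
have H u v : p u - p v <= p (u - v) by rewrite lerBlDr -{1}(subrK v u) seminormD.
by rewrite ler_norml H lerNl opprB seminorm_distC H.
Qed.

Definition seminorm_ker : {pred V} := fun x => p x == 0.

Fact seminorm_ker_zmod_closed : zmod_closed seminorm_ker.
Proof.
split=> [|x y]; rewrite -!topredE /= /seminorm_ker ?seminorm0// => /eqP x0 /eqP y0.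
by rewrite eq_le seminorm_ge0 (le_trans (seminormB x y))// x0 y0 addr0.
Qed.

HB.instance Definition _ :=
  GRing.isZmodClosed.Build V seminorm_ker seminorm_ker_zmod_closed.

Definition sepquot : Type := Quotient.quot seminorm_ker.

HB.instance Definition _ := GRing.Zmodule.on sepquot.
HB.instance Definition _ := EqQuotient.on sepquot.

Definition sepquot_pi (x : V) : sepquot := \pi_sepquot x.

Lemma sepquot_piP x y : sepquot_pi x = sepquot_pi y <-> p (x - y) = 0.
Proof.
split=> [/eqmodP|xy].
  by rewrite /= Quotient.equivE => /eqP.
by apply/eqmodP; rewrite /= Quotient.equivE; apply/eqP.
Qed.

Lemma sepquot_pi_surj (u : sepquot) : exists x, u = sepquot_pi x.
Proof. by exists (repr u); rewrite /sepquot_pi reprK. Qed.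

Lemma sepquot_piK (u : sepquot) : sepquot_pi (repr u) = u.
Proof. exact: reprK. Qed.

Fact sepquot_pi_zmod_morphism : zmod_morphism sepquot_pi.
Proof. by move=> x y; rewrite /sepquot_pi raddfB. Qed.

HB.instance Definition _ :=
  GRing.isZmodMorphism.Build V sepquot sepquot_pi sepquot_pi_zmod_morphism.

Definition sepquot_scale (a : K) (u : sepquot) : sepquot := sepquot_pi (a *: repr u).

Lemma sepquot_scale_pi a x : sepquot_scale a (sepquot_pi x) = sepquot_pi (a *: x).
Proof.
apply/sepquot_piP; rewrite -scalerBr seminormZ.
by have /sepquot_piP -> := sepquot_piK (sepquot_pi x); rewrite mulr0.
Qed.

Fact sepquot_scaleA a b u :
  sepquot_scale a (sepquot_scale b u) = sepquot_scale (a * b) u.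
Proof. by have [x ->] := sepquot_pi_surj u; rewrite !sepquot_scale_pi scalerA. Qed.

Fact sepquot_scale1 : left_id 1 sepquot_scale.
Proof.
by move=> u; have [x ->] := sepquot_pi_surj u; rewrite sepquot_scale_pi scale1r.
Qed.

Fact sepquot_scaleDr : right_distributive sepquot_scale +%R.
Proof.
move=> a u v; have [x ->] := sepquot_pi_surj u; have [y ->] := sepquot_pi_surj v.
by rewrite -raddfD !sepquot_scale_pi -raddfD scalerDr.
Qed.

Fact sepquot_scaleDl u : {morph sepquot_scale^~ u : a b / a + b}.
Proof.
move=> a b; have [x ->] := sepquot_pi_surj u.
by rewrite !sepquot_scale_pi -raddfD scalerDl.
Qed.

HB.instance Definition _ := GRing.Zmodule_isLmodule.Build K sepquot
  sepquot_scaleA sepquot_scale1 sepquot_scaleDr sepquot_scaleDl.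

Fact sepquot_pi_scalable : scalable sepquot_pi.
Proof. by move=> a x; rewrite -sepquot_scale_pi. Qed.

HB.instance Definition _ :=
  GRing.isScalable.Build K V sepquot _ sepquot_pi sepquot_pi_scalable.

Definition sepquot_rnorm (u : sepquot) : R := p (repr u).

Lemma sepquot_rnorm_pi x : sepquot_rnorm (sepquot_pi x) = p x.
Proof.
have /sepquot_piP H := sepquot_piK (sepquot_pi x).
apply/eqP; rewrite -subr_eq0 -normr_eq0 eq_le normr_ge0 andbT -H.
exact: ler_dist_seminorm.
Qed.

Definition sepquot_norm (u : sepquot) : K := of_real k (sepquot_rnorm u).

Fact sepquot_normD u v : sepquot_norm (u + v) <= sepquot_norm u + sepquot_norm v.
Proof.
have [x ->] := sepquot_pi_surj u; have [y ->] := sepquot_pi_surj v.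
rewrite -raddfD /sepquot_norm !sepquot_rnorm_pi -of_realD ler_of_real.
exact: seminormD.
Qed.

Fact sepquot_normZ a u : sepquot_norm (a *: u) = `|a| * sepquot_norm u.
Proof.
have [x ->] := sepquot_pi_surj u.
rewrite -linearZ /sepquot_norm !sepquot_rnorm_pi seminormZ of_realM.
by rewrite of_real_rabs.
Qed.

Fact sepquot_norm_eq0 u : sepquot_norm u = 0 -> u = 0.
Proof.
have [x ->] := sepquot_pi_surj u; rewrite /sepquot_norm sepquot_rnorm_pi.
rewrite -(of_real0 R k) => /of_real_inj x0.
by rewrite -(raddf0 sepquot_pi); apply/sepquot_piP; rewrite subr0.
Qed.

HB.instance Definition _ :=
  Lmodule_isNormed.Build K sepquot sepquot_normD sepquot_normZ sepquot_norm_eq0.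

Lemma rnorm_sepquot_pi x : rnorm (sepquot_pi x) = p x.
Proof. by rewrite /rnorm -[X in re_scalar X]/(sepquot_norm _) of_realK sepquot_rnorm_pi. Qed.

End separated_quotient.
Arguments sepquot_pi {R k V} p x.

Lemma cvg_exprV2 (R : realType) : (2 ^- n : R) @[n --> \oo] --> (0 : R).
Proof.
have H : `|2^-1 : R| < 1 by rewrite ger0_norm ?invr_ge0// invf_lt1// ltr1n.
by under eq_fun do rewrite -exprVn; exact: (cvg_expr H).
Qed.

Section rnorm_seminorm.
Variables (R : realType) (k : scalar_kind) (V : normedModType (scalar_field R k)).

Definition norm_seminorm : seminorm V :=
  Seminorm (@rnormD R k V) (@rnormZ R k V).

Lemma rnormN (x : V) : rnorm (- x) = rnorm x.
Proof. exact: (seminormN norm_seminorm). Qed.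

Lemma rnorm0 : rnorm (0 : V) = 0.
Proof. exact: (seminorm0 norm_seminorm). Qed.

Lemma rnormB (x y : V) : rnorm (x - y) <= rnorm x + rnorm y.
Proof. exact: (seminormB norm_seminorm). Qed.

Lemma rnorm_distC (x y : V) : rnorm (x - y) = rnorm (y - x).
Proof. exact: (seminorm_distC norm_seminorm). Qed.

Lemma ler_dist_rnorm (x y : V) : `|rnorm x - rnorm y| <= rnorm (x - y).
Proof. exact: (ler_dist_seminorm norm_seminorm). Qed.

Lemma rnorm_triangle (y x z : V) : rnorm (x - z) <= rnorm (x - y) + rnorm (y - z).
Proof. by rewrite -{1}(subrK y x) -addrA rnormD. Qed.

Lemma rnorm_cvgP (T : Type) (F : set_system T) (FF : Filter F) (f : T -> V) (l : V) :
  f @ F --> l <-> forall e : R, 0 < e -> \forall t \near F, rnorm (l - f t) < e.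
Proof.
split=> [/cvgrPdist_lt fl e e0|fl].
  have e0' : 0 < of_real k e by rewrite -(of_real0 R k) ltr_of_real.
  by apply: filterS (fl _ e0') => t; rewrite -of_real_rnorm ltr_of_real.
apply/cvgrPdist_lt => e e0.
apply: filterS (fl _ (re_scalar_gt0 e0)) => t lt.
by rewrite -of_real_rnorm -(re_scalarK (ltW e0)) ltr_of_real.
Qed.

Lemma cvg_rnorm (T : Type) (F : set_system T) (FF : Filter F) (f : T -> V) (l : V) :
  f @ F --> l -> rnorm (f t) @[t --> F] --> rnorm l.
Proof.
move=> /rnorm_cvgP fl; apply/cvgrPdist_lt => e e0.
apply: filterS (fl _ e0) => t; apply: le_lt_trans; exact: ler_dist_rnorm.
Qed.

(* Completeness reduces to the convergence of rapidly Cauchy sequences. *)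
Lemma rapid_complete :
  (forall u : nat -> V, (forall n, rnorm (u n.+1 - u n) <= 2 ^- n) -> cvgn u) ->
  forall F : set_system V, ProperFilter F -> cauchy F -> cvg F.
Proof.
move=> rapid F FF /cauchyP Fc.
have h0 n : 0 < (2 ^- n / 2 : R) by rewrite divr_gt0// invr_gt0 exprn_gt0.
have hex n : exists x : V, F [set y | rnorm (x - y) < 2 ^- n / 2].
  have e0' : 0 < of_real k (2 ^- n / 2 : R) by rewrite -(of_real0 R k) ltr_of_real.
  have [x Fx] := Fc _ e0'; exists x; apply: filterS Fx => y.
  by rewrite -ball_normE /= -of_real_rnorm ltr_of_real.
have [u hu] := choice hex.
have le2 n : (2 ^- n.+1 : R) <= 2 ^- n.
  by rewrite lef_pV2 ?posrE ?exprn_gt0// ler_eXn2l// ltr1n.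
have /rapid ucvg : forall n, rnorm (u n.+1 - u n) <= 2 ^- n.
  move=> n; have [y [y1 y2]] := filter_ex (filterI (hu n.+1) (hu n)).
  rewrite -(subrK y (u n.+1)) -addrA (le_trans (rnormD _ _))//.
  rewrite [leRHS]splitr lerD// ltW//; last by rewrite rnorm_distC.
  by apply: (lt_le_trans y1); rewrite ler_pM2r.
apply/cvg_ex; exists (limn u).
suff : id @ F --> limn u by [].
apply/rnorm_cvgP => e e0.
have /rnorm_cvgP ul : u n @[n --> \oo] --> limn u by [].
have e20 : 0 < e / 2 by rewrite divr_gt0.
have hgeo := @cvg_exprV2 R.
have [N [HN HN']] : exists N, rnorm (limn u - u N) < e / 2 /\ (2 ^- N : R) < e / 2.
  have /cvgrPdist_lt/(_ _ e20) H2 := hgeo.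
  have [N [H3 H4]] := filter_ex (filterI (ul _ e20) H2); exists N; split=> //.
  move: H4; rewrite sub0r normrN ger0_norm// invr_ge0 exprn_ge0//.
apply: filterS (hu N) => y yN.
rewrite -(subrK (u N) (limn u)) -addrA (le_lt_trans (rnormD _ _))//.
rewrite [ltRHS]splitr ltrD// (lt_trans yN)// (le_lt_trans _ HN')//.
by rewrite ler_pdivrMr// ler_peMr// ?invr_ge0 ?exprn_ge0// ler1n.
Qed.

End rnorm_seminorm.

Section limit_seminorm.
Variables (R : realType) (k : scalar_kind) (V W : lmodType (scalar_field R k)).
Variables (p : seminorm V) (I : Type) (F : set_system I) (FF : ProperFilter F).
Variable ev : W -> I -> V.
Hypothesis evD : forall w w' i, ev (w + w') i = ev w i + ev w' i.
Hypothesis evZ : forall a w i, ev (a *: w) i = a *: ev w i.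
Hypothesis ev_cvg : forall w, cvg (p (ev w i) @[i --> F]).

Let s (w : W) : R := lim (p (ev w i) @[i --> F]).

Fact limit_seminormD w w' : s (w + w') <= s w + s w'.
Proof.
rewrite -subr_ge0.
have H : p (ev w i) + p (ev w' i) - p (ev (w + w') i) @[i --> F]
    --> s w + s w' - s (w + w').
  by apply: cvgB; [apply: cvgD|]; exact: ev_cvg.
rewrite -(cvg_lim _ H)//; apply: limr_ge; first by apply/cvg_ex; eexists; exact: H.
by apply: nearW => i /=; rewrite evD subr_ge0 seminormD.
Qed.

Fact limit_seminormZ a w : s (a *: w) = rabs a * s w.
Proof.
apply/cvg_lim => //; under eq_fun do rewrite evZ seminormZ.
exact: cvgM (cvg_cst _) _.
Qed.

Definition limit_seminorm : seminorm W := Seminorm limit_seminormD limit_seminormZ.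

End limit_seminorm.

Section completion.
Variables (R : realType) (k : scalar_kind) (V : lmodType (scalar_field R k)).
Variable p : seminorm V.
Local Notation K := (scalar_field R k).

Definition cauchy_seq : {pred nat -> V} := fun u =>
  `[< forall e : R, 0 < e ->
      exists N, forall m n, (N <= m)%N -> (N <= n)%N -> p (u m - u n) < e >].

Fact cauchy_seq_submod_closed : submod_closed cauchy_seq.
Proof.
split=> [|a u v /asboolP uc /asboolP vc].
  by apply/asboolP => e e0; exists 0%N => m n _ _; rewrite subrr seminorm0.
apply/asboolP => e e0.
have a0 : 0 < rabs a + 1 by rewrite ltr_wpDl// rabs_ge0.
have [|N HN] := uc (e / 2 / (rabs a + 1)); first by rewrite !divr_gt0.
have [|M HM] := vc (e / 2); first by rewrite divr_gt0.
exists (maxn N M) => m n; rewrite !geq_max => /andP[Nm Mm] /andP[Nn Mn].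
rewrite [X in p X](_ : _ = a *: (u m - u n) + (v m - v n)); last first.
  by rewrite !fctE scalerBr opprD addrACA.
rewrite (le_lt_trans (seminormD _ _ _))// [ltRHS]splitr ler_ltD ?HM//.
rewrite seminormZ (@le_trans _ _ ((rabs a + 1) * p (u m - u n)))//.
  by rewrite ler_wpM2r ?seminorm_ge0// lerDl.
by rewrite mulrC -ler_pdivlMr// ltW// HN.
Qed.

HB.instance Definition _ :=
  GRing.isSubmodClosed.Build K (nat -> V) cauchy_seq cauchy_seq_submod_closed.

Record cauchy_type :=
  CauchySeq { cauchy_fun :> nat -> V; cauchy_funP : cauchy_fun \in cauchy_seq }.

HB.instance Definition _ := [isSub for cauchy_fun].
HB.instance Definition _ := [Choice of cauchy_type by <:].
HB.instance Definition _ := [SubChoice_isSubLmodule of cauchy_type by <:].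

Lemma cauchy_typeP (u : cauchy_type) (e : R) : 0 < e ->
  exists N, forall m n, (N <= m)%N -> (N <= n)%N -> p (u m - u n) < e.
Proof. by move=> e0; have /asboolP/(_ _ e0) := cauchy_funP u. Qed.

Fact cauchy_seminorm_cvg (u : cauchy_type) : cvgn (fun n => p (u n)).
Proof.
apply/cauchy_cvgP/cauchyP => e e0; have [N HN] := cauchy_typeP u e0.
exists (p (u N)); exists N => // n /= Nn; rewrite -ball_normE /=.
exact: le_lt_trans (ler_dist_seminorm _ _ _) (HN _ _ _ _).
Qed.

Definition cauchy_seminorm : seminorm cauchy_type :=
  @limit_seminorm R k V cauchy_type p nat \oo _ cauchy_fun
    (fun _ _ _ => erefl) (fun _ _ _ => erefl) cauchy_seminorm_cvg.

(* The completion of V for p, by Cauchy sequences. *)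
Definition completion : Type := sepquot cauchy_seminorm.

HB.instance Definition _ := NormedModule.on completion.

Fact cst_cauchy (x : V) : (fun _ : nat => x) \in cauchy_seq.
Proof. by apply/asboolP => e e0; exists 0%N => m n _ _; rewrite subrr seminorm0. Qed.

Definition completion_in (x : V) : completion :=
  sepquot_pi cauchy_seminorm (CauchySeq (cst_cauchy x)).

Fact completion_in_linear : linear completion_in.
Proof.
move=> a x y; rewrite /completion_in -linearP; congr sepquot_pi.
exact: val_inj.
Qed.

HB.instance Definition _ :=
  GRing.isLinear.Build K V completion _ completion_in completion_in_linear.

Lemma rnorm_completion_in x : rnorm (completion_in x) = p x.
Proof. rewrite rnorm_sepquot_pi; apply: lim_cst; [exact: Rhausdorff|exact: eventually_filter]. Qed.

Lemma cvg_completion_in (u : cauchy_type) :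
  completion_in (u n) @[n --> \oo] --> (sepquot_pi cauchy_seminorm u : completion).
Proof.
apply/rnorm_cvgP => e e0; have e20 : 0 < e / 2 by rewrite divr_gt0.
have [N HN] := cauchy_typeP u e20.
exists N => // n /= Nn.
rewrite -raddfB rnorm_sepquot_pi (@le_lt_trans _ _ (e / 2))//; last first.
  by rewrite ltr_pdivrMr// ltr_pMr// ltr1n.
apply: limr_le; first exact: cauchy_seminorm_cvg.
by exists N => // m /= Nm; apply/ltW/HN.
Qed.

Lemma completion_in_dense (w : completion) (e : R) : 0 < e ->
  exists x, rnorm (w - completion_in x) < e.
Proof.
move=> e0; have [u ->] := sepquot_pi_surj w.
have /rnorm_cvgP/(_ _ e0) := @cvg_completion_in u.
by move=> /filter_ex[n Hn]; exists (u n).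
Qed.

Fact completion_complete (F : set_system completion) :
  ProperFilter F -> cauchy F -> cvg F.
Proof.
apply: rapid_complete => w wrapid.
have h0 n : 0 < (2 ^- n : R) by rewrite invr_gt0 exprn_gt0.
have [v hv] := choice (fun n => completion_in_dense (w n) (h0 n)).
have hgeo := @cvg_exprV2 R.
have wtail n j : rnorm (w (n + j)%N - w n) <= 2 * 2 ^- n - 2 * 2 ^- (n + j).
  elim: j => [|j IH]; first by rewrite addn0 !subrr rnorm0.
  rewrite -(subrK (w (n + j)%N) (w (n + j.+1)%N)) -addrA (le_trans (rnormD _ _))//.
  rewrite addnS (le_trans (lerD (wrapid _) IH))//.
  rewrite exprS invfM; lra.
have wtail' n j : rnorm (w (n + j)%N - w n) <= 2 * 2 ^- n.
  by rewrite (le_trans (wtail _ _))// gerBl// mulr_ge0// ltW.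
have vc : v \in cauchy_seq.
  apply/asboolP => e e0; have e40 : 0 < e / 8 by rewrite divr_gt0.
  have /cvgrPdist_lt/(_ _ e40)[N _ HN] := hgeo.
  have {}HN n : (N <= n)%N -> (2 ^- n : R) < e / 8.
    by move=> /HN; rewrite sub0r normrN ger0_norm// ltW.
  have H n : (N <= n)%N -> rnorm (w N - completion_in (v n)) < e / 2.
    move=> Nn; rewrite -(subrK (w n) (w N)) -addrA (le_lt_trans (rnormD _ _))//.
    rewrite (@le_lt_trans _ _ (2 * 2 ^- N + 2 ^- n))// ?lerD//.
    - by rewrite rnorm_distC -(subnKC Nn).
    - exact/ltW.
    - have := HN _ (leqnn N); have := HN _ Nn => h1 h2.
      have -> : e / 2 = 3 * (e / 8) + e / 8 by field.
      lra.
  exists N => m n Nm Nn.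
  rewrite -rnorm_completion_in raddfB (le_lt_trans (rnorm_triangle (w N) _ _))//.
  by rewrite [ltRHS]splitr ltrD ?H// rnorm_distC H.
apply/cvg_ex; exists (sepquot_pi cauchy_seminorm (CauchySeq vc) : completion).
apply/rnorm_cvgP => e e0; have e20 : 0 < e / 2 by rewrite divr_gt0.
have /rnorm_cvgP/(_ _ e20) H1 := @cvg_completion_in (CauchySeq vc).
have /cvgrPdist_lt/(_ _ e20) H2 := hgeo.
apply: filterS2 H1 H2 => n H1 H2.
rewrite (le_lt_trans (rnorm_triangle (completion_in (v n)) _ _))// [ltRHS]splitr.
rewrite ltrD// rnorm_distC.
apply: (lt_trans (hv n)).
by move: H2; rewrite sub0r normrN ger0_norm// ltW.
Qed.

HB.instance Definition _ := Uniform_isComplete.Build completion completion_complete.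

End completion.

Section ultrapower.
Variables (R : realType) (k : scalar_kind) (I : Type) (U : set_system I).
Variables (UU : UltraFilter U) (E : completeNormedModType (scalar_field R k)).
Local Notation K := (scalar_field R k).

Lemma ultra_bounded_cvg (f : I -> R) (M : R) :
  (forall i, `|f i| <= M) -> cvg (f @ U).
Proof.
move=> fM; have fI : (f @ U) [set` `[- M, M]].
  by apply: nearW => i; rewrite /= in_itv /= -ler_norml.
have [l [_ lcl]] := @segment_compact R (- M) M _ _ fI.
apply/cvg_ex; exists l => B Bl; rewrite nbhs_filterE.
have [//|nB] := in_ultra_setVsetC (f @^-1` B) UU.
by have [x [nBx Bx]] := lcl (~` B) B nB Bl.
Qed.

Definition linfty : {pred I -> E} := fun f =>
  `[< exists M : R, forall i, rnorm (f i) <= M >].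

Fact linfty_submod_closed : submod_closed linfty.
Proof.
split=> [|a f g /asboolP[M fM] /asboolP[N gN]]; apply/asboolP.
  by exists 0 => i; rewrite rnorm0.
exists (rabs a * M + N) => i; rewrite (le_trans (rnormD _ _))// lerD// rnormZ.
by rewrite ler_wpM2l ?rabs_ge0.
Qed.

HB.instance Definition _ :=
  GRing.isSubmodClosed.Build K (I -> E) linfty linfty_submod_closed.

Record linfty_type :=
  Linfty { linfty_fun :> I -> E; linfty_funP : linfty_fun \in linfty }.

HB.instance Definition _ := [isSub for linfty_fun].
HB.instance Definition _ := [Choice of linfty_type by <:].
HB.instance Definition _ := [SubChoice_isSubLmodule of linfty_type by <:].

Lemma linfty_bounded (f : linfty_type) :
  exists2 M : R, 0 <= M & forall i, rnorm (f i) <= M.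
Proof.
have /asboolP[M fM] := linfty_funP f; exists (Num.max 0 M).
  by rewrite le_max lexx.
by move=> i; rewrite le_max fM orbT.
Qed.

Fact linfty_cvg (f : linfty_type) : cvg (rnorm (f i) @[i --> U]).
Proof.
have [M _ fM] := linfty_bounded f.
by apply: (@ultra_bounded_cvg _ M) => i; rewrite ger0_norm ?rnorm_ge0.
Qed.

Definition ultra_seminorm : seminorm linfty_type :=
  @limit_seminorm R k E linfty_type (norm_seminorm E) I U _ linfty_fun
    (fun _ _ _ => erefl) (fun _ _ _ => erefl) linfty_cvg.

Lemma ultra_seminormE (f : linfty_type) :
  ultra_seminorm f = lim (rnorm (f i) @[i --> U]).
Proof. by []. Qed.

Definition ultrapower : Type := sepquot ultra_seminorm.

HB.instance Definition _ := NormedModule.on ultrapower.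

Definition ultra_pi : {linear linfty_type -> ultrapower} := sepquot_pi ultra_seminorm.

Lemma rnorm_ultra_pi f : rnorm (ultra_pi f) = lim (rnorm (f i) @[i --> U]).
Proof. exact: rnorm_sepquot_pi. Qed.

Lemma ultra_pi_surj (u : ultrapower) : exists f, u = ultra_pi f.
Proof. exact: sepquot_pi_surj. Qed.

Lemma ultra_piP f g :
  ultra_pi f = ultra_pi g <-> lim (rnorm (f i - g i) @[i --> U]) = 0.
Proof. exact: (sepquot_piP ultra_seminorm). Qed.

Lemma ultra_pi_small (u : ultrapower) (e : R) : rnorm u < e ->
  exists2 f, u = ultra_pi f & forall i, rnorm (f i) <= e.
Proof.
move=> ue; have [f uf] := ultra_pi_surj u.
have e0 : 0 < e := le_lt_trans (rnorm_ge0 _) ue.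
pose g i := if rnorm (f i) <= e then f i else 0.
have ge i : rnorm (g i) <= e by rewrite /g; case: ifP => // _; rewrite rnorm0 ltW.
have gl : g \in linfty by apply/asboolP; exists e.
exists (Linfty gl) => //.
rewrite uf; apply/ultra_piP; apply/cvg_lim => //.
apply: cvg_near_cst.
have /cvgrPdist_lt/(_ (e - rnorm u)) := @linfty_cvg f.
rewrite subr_gt0 => /(_ ue); apply: filterS => i.
rewrite -rnorm_ultra_pi -uf => H; rewrite /= /g ifT ?subrr ?rnorm0//.
rewrite distrC in H; have := le_lt_trans (ler_norm _) H.
by rewrite ltrBlDr subrK => /ltW.
Qed.

End ultrapower.

Section geometric.
Variables (R : realType) (k : scalar_kind) (V : normedModType (scalar_field R k)).
Variables (u : nat -> V) (C : R).
Hypothesis uC : forall n, rnorm (u n.+1 - u n) <= C * 2 ^- n.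

Lemma geometric_tail n j : rnorm (u (n + j)%N - u n) <= 2 * C * 2 ^- n.
Proof.
have C0 : 0 <= C by have := le_trans (rnorm_ge0 _) (uC 0); rewrite expr0 invr1 mulr1.
have h0 m : 0 < (2 ^- m : R) by rewrite invr_gt0 exprn_gt0.
suff H : rnorm (u (n + j)%N - u n) <= 2 * C * 2 ^- n - 2 * C * 2 ^- (n + j).
  by rewrite (le_trans H)// gerBl !mulr_ge0// ltW.
elim: j => [|j IH]; first by rewrite addn0 !subrr rnorm0.
rewrite (le_trans (rnorm_triangle (u (n + j)%N) _ _))//.
rewrite addnS (le_trans (lerD (uC _) IH))//.
rewrite exprS invfM; lra.
Qed.

End geometric.

Section geometric_complete.
Variables (R : realType) (k : scalar_kind) (V : completeNormedModType (scalar_field R k)).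
Variables (u : nat -> V) (C : R).
Hypothesis uC : forall n, rnorm (u n.+1 - u n) <= C * 2 ^- n.

Lemma geometric_cvg : cvgn u.
Proof.
apply: cauchy_cvg; apply: cauchy_exP => e e0.
have h : (2 * C * 2 ^- n : R) @[n --> \oo] --> 2 * C * (0 : R).
  by apply: cvgM; [exact: cvg_cst|exact: cvg_exprV2].
rewrite mulr0 in h.
have /cvgrPdist_lt/(_ _ (re_scalar_gt0 e0))[N _ HN] := h.
exists (u N); exists N => // n /= Nn; rewrite -ball_normE /=.
rewrite -of_real_rnorm -(re_scalarK (ltW e0)) ltr_of_real rnorm_distC -(subnKC Nn).
apply: le_lt_trans (geometric_tail uC _ _) _.
by have := HN N (leqnn N); rewrite sub0r normrN; apply: le_lt_trans; exact: ler_norm.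
Qed.

Lemma geometric_lim n : rnorm (limn u - u n) <= 2 * C * 2 ^- n.
Proof.
apply/ler_addgt0Pr => e e0.
have /rnorm_cvgP/(_ _ e0)[N _ HN] := geometric_cvg.
rewrite (le_trans (rnorm_triangle (u (n + N)%N) _ _))// addrC lerD//.
  exact: geometric_tail.
by rewrite ltW// HN//= leq_addl.
Qed.

End geometric_complete.

Section ultrapower_complete.
Variables (R : realType) (k : scalar_kind) (I : Type) (U : set_system I).
Variables (UU : UltraFilter U) (E : completeNormedModType (scalar_field R k)).

Fact ultrapower_complete (F : set_system (ultrapower UU E)) :
  ProperFilter F -> cauchy F -> cvg F.
Proof.
apply: rapid_complete => u urapid.
have h0 n : 0 < (2 ^- n : R) by rewrite invr_gt0 exprn_gt0.
have hex n : exists f : linfty_type I E,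
    u n.+1 - u n = ultra_pi UU E f /\ forall i, rnorm (f i) <= 2 * 2 ^- n.
  have [|f] := @ultra_pi_small R k I U UU E (u n.+1 - u n) (2 * 2 ^- n).
    by rewrite (le_lt_trans (urapid n))// ltr_pMl// ltr1n.
  by exists f.
have [d hd] := choice hex.
have [f0 uf0] := ultra_pi_surj (u 0%N).
pose v n := f0 + \sum_(j < n) d j.
have vE n : u n = ultra_pi UU E (v n).
  elim: n => [|n IH]; first by rewrite /v big_ord0 addr0.
  by rewrite /v big_ord_recr /= addrA raddfD /= -/(v n) -IH -(hd n).1 addrC subrK.
have vg i n : rnorm (v n.+1 i - v n i) <= 2 * 2 ^- n.
  rewrite (_ : v n.+1 i - v n i = d n i) ?(hd n).2//.
  have -> : v n.+1 = v n + d n by rewrite /v big_ord_recr addrA.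
  by rewrite [X in X - _](_ : _ = v n i + d n i)// addrC addKr.
pose g i := limn (fun n => v n i).
have gv i n : rnorm (g i - v n i) <= 2 * 2 * 2 ^- n := geometric_lim (vg i) n.
have gl : g \in @linfty R k I E.
  have [M _ fM] := linfty_bounded (v 0%N).
  apply/asboolP; exists (2 * 2 + M) => i.
  rewrite -(subrK (v 0%N i) (g i)) (le_trans (rnormD _ _))// lerD//.
  by rewrite (le_trans (gv i 0%N))// expr0 invr1 mulr1.
apply/cvg_ex; exists (ultra_pi UU E (Linfty gl)).
apply/rnorm_cvgP => e e0.
have h : (2 * 2 * 2 ^- n : R) @[n --> \oo] --> 2 * 2 * (0 : R).
  by apply: cvgM; [exact: cvg_cst|exact: cvg_exprV2].
rewrite mulr0 in h.
have /cvgrPdist_lt/(_ _ e0) := h; apply: filterS => n.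
rewrite sub0r normrN => H; apply: le_lt_trans (le_lt_trans (ler_norm _) H).
rewrite vE -raddfB rnorm_ultra_pi; apply: limr_le; first exact: linfty_cvg.
by apply: nearW => i; exact: gv.
Qed.

HB.instance Definition _ :=
  Uniform_isComplete.Build (ultrapower UU E) ultrapower_complete.

End ultrapower_complete.

(* The algebraic tensor product: finite lists of pairs, read as sums of
   elementary tensors, modulo the congruence generated by bilinearity. *)
Section tensor.
Variables (K : fieldType) (E F : lmodType K).
Implicit Types (s t : seq (E * F)) (x : E) (y : F).

Inductive tensor_rel : seq (E * F) -> seq (E * F) -> Prop :=
| tensor_refl s : tensor_rel s s
| tensor_sym s t : tensor_rel s t -> tensor_rel t s
| tensor_trans s t r : tensor_rel s t -> tensor_rel t r -> tensor_rel s r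
| tensor_cat s s' t t' :
    tensor_rel s s' -> tensor_rel t t' -> tensor_rel (s ++ t) (s' ++ t')
| tensor_catC s t : tensor_rel (s ++ t) (t ++ s)
| tensor_0 y : tensor_rel [:: (0, y)] [::]
| tensor_Dl x x' y : tensor_rel [:: (x + x', y)] [:: (x, y); (x', y)]
| tensor_Dr x y y' : tensor_rel [:: (x, y + y')] [:: (x, y); (x, y')]
| tensor_Z a x y : tensor_rel [:: (a *: x, y)] [:: (x, a *: y)].

Definition tensor_equiv s t : bool := `[< tensor_rel s t >].

Fact tensor_equiv_is_equiv : equiv_class_of tensor_equiv.
Proof.
split=> [s|s t|t s r]; first exact/asboolP/tensor_refl.
  by apply/asboolP/asboolP => /tensor_sym.
by move=> /asboolP st /asboolP tr; apply/asboolP; exact: tensor_trans tr.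
Qed.

Canonical tensor_equivrel := EquivRelPack tensor_equiv_is_equiv.

Definition tensor : Type := {eq_quot tensor_equiv}.

HB.instance Definition _ := Choice.on tensor.
HB.instance Definition _ := EqQuotient.on tensor.

Definition tensor_pi s : tensor := \pi_tensor s.

Lemma tensor_piP s t : tensor_pi s = tensor_pi t <-> tensor_rel s t.
Proof. by split=> [/eqmodP/asboolP|st]; [|apply/eqmodP/asboolP]. Qed.

Lemma tensor_piK (u : tensor) : tensor_pi (repr u) = u.
Proof. exact: reprK. Qed.

Definition tensor_scale_seq (a : K) s := [seq (a *: xy.1, xy.2) | xy <- s].

Lemma tensor_scale_rel a s t :
  tensor_rel s t -> tensor_rel (tensor_scale_seq a s) (tensor_scale_seq a t).
Proof.
elim=> {s t}.
- by move=> s; exact: tensor_refl.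
- by move=> s t _; exact: tensor_sym.
- by move=> s t r _ + _; exact: tensor_trans.
- by move=> s s' t t' _ + _; rewrite /tensor_scale_seq !map_cat; exact: tensor_cat.
- by move=> s t; rewrite /tensor_scale_seq !map_cat; exact: tensor_catC.
- by move=> y; rewrite /= scaler0; exact: tensor_0.
- by move=> x x' y; rewrite /= scalerDr; exact: tensor_Dl.
- by move=> x y y'; exact: tensor_Dr.
- by move=> b x y; rewrite /= scalerA mulrC -scalerA; exact: tensor_Z.
Qed.

Definition tensor_add (u v : tensor) := tensor_pi (repr u ++ repr v).
Definition tensor_scale a (u : tensor) := tensor_pi (tensor_scale_seq a (repr u)).
Definition tensor_zero := tensor_pi [::].
Definition tensor_opp := tensor_scale (-1).

Lemma tensor_add_pi s t : tensor_add (tensor_pi s) (tensor_pi t) = tensor_pi (s ++ t).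
Proof. by apply/tensor_piP/tensor_cat; apply/tensor_piP/tensor_piK. Qed.

Lemma tensor_scale_pi a s :
  tensor_scale a (tensor_pi s) = tensor_pi (tensor_scale_seq a s).
Proof. by apply/tensor_piP/tensor_scale_rel/tensor_piP/tensor_piK. Qed.

Fact tensor_addA : associative tensor_add.
Proof.
move=> u v w; rewrite -(tensor_piK u) -(tensor_piK v) -(tensor_piK w).
by rewrite !tensor_add_pi catA.
Qed.

Fact tensor_addC : commutative tensor_add.
Proof. by move=> u v; apply/tensor_piP/tensor_catC. Qed.

Fact tensor_add0 : left_id tensor_zero tensor_add.
Proof. by move=> u; rewrite -(tensor_piK u) tensor_add_pi. Qed.

Fact tensor_scaleDr a (u v : tensor) :
  tensor_scale a (tensor_add u v) = tensor_add (tensor_scale a u) (tensor_scale a v).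
Proof.
rewrite -(tensor_piK u) -(tensor_piK v) tensor_add_pi !tensor_scale_pi.
by rewrite tensor_add_pi /tensor_scale_seq map_cat.
Qed.

Fact tensor_scaleDl (u : tensor) a b :
  tensor_scale (a + b) u = tensor_add (tensor_scale a u) (tensor_scale b u).
Proof.
rewrite -(tensor_piK u); elim: (repr u) => [|[x y] s IH].
  by rewrite !tensor_scale_pi tensor_add_pi.
rewrite -cat1s -tensor_add_pi !tensor_scaleDr IH.
have -> : tensor_scale (a + b) (tensor_pi [:: (x, y)]) =
    tensor_add (tensor_scale a (tensor_pi [:: (x, y)]))
               (tensor_scale b (tensor_pi [:: (x, y)])).
  rewrite !tensor_scale_pi tensor_add_pi; apply/tensor_piP.
  by rewrite /= scalerDl; exact: tensor_Dl.
rewrite !tensor_addA; congr tensor_add; rewrite -!tensor_addA; congr tensor_add.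
exact: tensor_addC.
Qed.

Fact tensor_scale0 (u : tensor) : tensor_scale 0 u = tensor_zero.
Proof.
rewrite -(tensor_piK u); elim: (repr u) => [|[x y] s IH].
  by rewrite tensor_scale_pi.
rewrite -cat1s -tensor_add_pi tensor_scaleDr IH tensor_addC tensor_add0.
by rewrite tensor_scale_pi; apply/tensor_piP; rewrite /= scale0r; exact: tensor_0.
Qed.

Fact tensor_scale1 : left_id 1 tensor_scale.
Proof.
move=> u; rewrite -[RHS]tensor_piK; congr tensor_pi.
by elim: (repr u) => //= -[x y] s ->; rewrite scale1r.
Qed.

Fact tensor_scaleA a b (u : tensor) :
  tensor_scale a (tensor_scale b u) = tensor_scale (a * b) u.
Proof.
rewrite -(tensor_piK u) !tensor_scale_pi; congr tensor_pi.
by rewrite /tensor_scale_seq -map_comp; apply: eq_map => -[x y] /=; rewrite scalerA.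
Qed.

Fact tensor_addN : left_inverse tensor_zero tensor_opp tensor_add.
Proof.
by move=> u; rewrite -{2}(tensor_scale1 u) -tensor_scaleDl addNr tensor_scale0.
Qed.

HB.instance Definition _ :=
  GRing.isZmodule.Build tensor tensor_addA tensor_addC tensor_add0 tensor_addN.

HB.instance Definition _ := GRing.Zmodule_isLmodule.Build K tensor
  tensor_scaleA tensor_scale1 tensor_scaleDr tensor_scaleDl.

Definition tens x y : tensor := tensor_pi [:: (x, y)].

Fact tens_is_bilinear : bilinear_for *:%R *:%R tens.
Proof.
split=> [y a x x'|x a y y']; rewrite /=.
  have -> : a *: tens x y = tensor_pi [:: (a *: x, y)] by exact: tensor_scale_pi.
  rewrite [RHS]tensor_add_pi; apply/tensor_piP; exact: tensor_Dl.
have -> : a *: tens x y = tensor_pi [:: (x, a *: y)].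
  by rewrite [LHS]tensor_scale_pi; apply/tensor_piP; exact: tensor_Z.
rewrite [RHS]tensor_add_pi; apply/tensor_piP; exact: tensor_Dr.
Qed.

HB.instance Definition _ :=
  bilinear_isBilinear.Build K E F tensor *:%R *:%R tens tens_is_bilinear.

Lemma tensor_piE s : tensor_pi s = \sum_(xy <- s) tens xy.1 xy.2.
Proof.
elim: s => [|[x y] s IH]; first by rewrite big_nil.
by rewrite big_cons /= -IH; symmetry; exact: tensor_add_pi.
Qed.

Lemma tensor_sum (u : tensor) : exists s, u = \sum_(xy <- s) tens xy.1 xy.2.
Proof. by exists (repr u); rewrite -tensor_piE tensor_piK. Qed.

Section lift.
Variables (G : lmodType K) (f : {bilinear E -> F -> G}).

Lemma tensor_rel_sum s t : tensor_rel s t ->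
  \sum_(xy <- s) f xy.1 xy.2 = \sum_(xy <- t) f xy.1 xy.2.
Proof.
elim=> {s t}.
- by [].
- by move=> s t _ ->.
- by move=> s t r _ -> _ ->.
- by move=> s s' t t' _ e _ e'; rewrite !big_cat /= e e'.
- by move=> s t; rewrite !big_cat /= addrC.
- by move=> y; rewrite big_seq1 big_nil /= linear0l.
- by move=> x x' y; rewrite !big_cons !big_nil /= linearDl !addr0.
- by move=> x y y'; rewrite !big_cons !big_nil /= linearDr !addr0.
- by move=> a x y; rewrite !big_seq1 /= linearZl_LR linearZr_LR.
Qed.

Definition tensor_lift (u : tensor) : G := \sum_(xy <- repr u) f xy.1 xy.2.

Lemma tensor_lift_pi s : tensor_lift (tensor_pi s) = \sum_(xy <- s) f xy.1 xy.2.
Proof. exact/tensor_rel_sum/tensor_piP/tensor_piK. Qed.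

Fact tensor_lift_linear : linear tensor_lift.
Proof.
move=> a u v; rewrite -(tensor_piK u) -(tensor_piK v).
rewrite [a *: _]tensor_scale_pi [_ + _ in LHS]tensor_add_pi !tensor_lift_pi.
rewrite big_cat /= big_map /= scaler_sumr; congr (_ + _).
by apply: eq_bigr => xy _; rewrite linearZl_LR.
Qed.

HB.instance Definition _ :=
  GRing.isLinear.Build K tensor G _ tensor_lift tensor_lift_linear.

Lemma tensor_lift_tens x y : tensor_lift (tens x y) = f x y.
Proof. by rewrite tensor_lift_pi big_seq1. Qed.

End lift.
End tensor.
Arguments tens {K E F} x y.

Section projective_tensor.
Variables (R : realType) (k : scalar_kind) (E F : completeNormedModType (scalar_field R k)).
Local Notation K := (scalar_field R k).
Implicit Types u v : tensor E F.

Definition proj_cost (s : seq (E * F)) : R :=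
  \sum_(xy <- s) rnorm xy.1 * rnorm xy.2.

Definition proj_norm u : R :=
  inf [set proj_cost s | s in [set s | u = \sum_(xy <- s) tens xy.1 xy.2]].

Lemma proj_cost_ge0 s : 0 <= proj_cost s.
Proof. by apply: sumr_ge0 => xy _; rewrite mulr_ge0 ?rnorm_ge0. Qed.

Lemma proj_norm_le s : proj_norm (\sum_(xy <- s) tens xy.1 xy.2) <= proj_cost s.
Proof.
apply: ge_inf; last by exists s.
by exists 0 => _ [t _ <-]; exact: proj_cost_ge0.
Qed.

Lemma le_proj_norm u (r : R) :
  (forall s, u = \sum_(xy <- s) tens xy.1 xy.2 -> r <= proj_cost s) ->
  r <= proj_norm u.
Proof.
move=> H; apply: lb_le_inf; last by move=> _ [s us <-]; exact: H.
by have [s us] := tensor_sum u; exists (proj_cost s), s.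
Qed.

Fact proj_normD u v : proj_norm (u + v) <= proj_norm u + proj_norm v.
Proof.
rewrite -lerBlDr; apply: le_proj_norm => s us.
rewrite lerBlDr [leRHS]addrC -lerBlDr; apply: le_proj_norm => t vt.
rewrite lerBlDr [leRHS]addrC us vt -big_cat (le_trans (proj_norm_le _))//.
by rewrite /proj_cost big_cat.
Qed.

Fact proj_normZ (a : K) u : proj_norm (a *: u) = rabs a * proj_norm u.
Proof.
have H (b : K) v s : v = \sum_(xy <- s) tens xy.1 xy.2 ->
    proj_norm (b *: v) <= rabs b * proj_cost s.
  move=> ->; rewrite scaler_sumr.
  have -> : \sum_(xy <- s) b *: tens xy.1 xy.2 =
      \sum_(xy <- tensor_scale_seq b s) tens xy.1 xy.2.
    by rewrite big_map; apply: eq_bigr => xy _; rewrite linearZl_LR.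
  rewrite (le_trans (proj_norm_le _))// /proj_cost big_map mulr_sumr.
  by apply: ler_sum => xy _; rewrite rnormZ mulrA.
have le (b : K) v : proj_norm (b *: v) <= rabs b * proj_norm v.
  have [b0|b0] := eqVneq (rabs b) 0.
    by have [s vs] := tensor_sum v; rewrite (le_trans (H _ _ _ vs))// b0 !mul0r.
  have bgt0 : 0 < rabs b by rewrite lt_def b0 rabs_ge0.
  by rewrite -ler_pdivrMl//; apply: le_proj_norm => s vs; rewrite ler_pdivrMl// H.
apply/eqP; rewrite eq_le le /=.
have [->|a0] := eqVneq a 0.
  rewrite rabs0 mul0r; apply: le_proj_norm => s _; exact: proj_cost_ge0.
have a'0 : rabs a != 0 by apply: contra_neq a0 => /rabs_eq0.
have agt0 : 0 < rabs a by rewrite lt_def a'0 rabs_ge0.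
rewrite -ler_pdivlMl// -{1}(scale1r u) -(mulVf a0) -scalerA (le_trans (le _ _))//.
rewrite (_ : rabs a^-1 = (rabs a)^-1)//; apply: (mulfI a'0).
by rewrite -rabsM mulfV// mulfV// /rabs normr1 -(of_real1 R k) of_realK.
Qed.

Definition proj_seminorm : seminorm (tensor E F) := Seminorm proj_normD proj_normZ.

(* Passing to the completion kills the kernel of proj_seminorm (which is in fact
   trivial), so no separation property is needed beforehand. *)
Definition ptensor : Type := completion proj_seminorm.

HB.instance Definition _ := CompleteNormedModule.on ptensor.

Definition ptens (x : E) (y : F) : ptensor := completion_in proj_seminorm (tens x y).

Fact ptens_is_bilinear : bilinear_for *:%R *:%R ptens.
Proof. by split=> [y|x] a z z'; rewrite /ptens /= (linearPl, linearPr) linearP. Qed.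

HB.instance Definition _ :=
  bilinear_isBilinear.Build K E F ptensor *:%R *:%R ptens ptens_is_bilinear.

Lemma rnorm_ptens_le x y : rnorm (ptens x y) <= rnorm x * rnorm y.
Proof.
rewrite rnorm_completion_in; have := proj_norm_le [:: (x, y)].
by rewrite /proj_cost !big_seq1.
Qed.

End projective_tensor.

Record contraction (R : realType) (k : scalar_kind) (V : lmodType (scalar_field R k))
    (p : seminorm V) (G : normedModType (scalar_field R k)) := Contraction {
  contraction_fun :> {linear V -> G};
  contractionP : forall x, rnorm (contraction_fun x) <= p x }.

Section completion_lift.
Variables (R : realType) (k : scalar_kind) (V : lmodType (scalar_field R k)).
Variables (p : seminorm V) (G : completeNormedModType (scalar_field R k)).
Local Notation K := (scalar_field R k).
Variable f : contraction p G.

Fact contraction_cvg (u : cauchy_type p) : cvgn (fun n => f (u n)).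
Proof.
apply: cauchy_cvg; apply: cauchy_exP => e e0.
have [N HN] := cauchy_typeP u (re_scalar_gt0 e0).
exists (f (u N)); exists N => // n /= Nn; rewrite -ball_normE /=.
rewrite -of_real_rnorm -(re_scalarK (ltW e0)) ltr_of_real -raddfB.
exact: le_lt_trans (contractionP _ _) (HN _ _ _ _).
Qed.

Definition completion_lift (w : completion p) : G :=
  limn (fun n => f ((repr w : cauchy_type p) n)).

Lemma completion_lift_pi (u : cauchy_type p) :
  completion_lift (sepquot_pi _ u) = limn (fun n => f (u n)).
Proof.
have /sepquot_piP H := sepquot_piK (sepquot_pi (cauchy_seminorm p) u).
rewrite /completion_lift; set v := repr _ in H *.
apply/cvg_lim => //; apply/rnorm_cvgP => e e0; have e20 : 0 < e / 2 by rewrite divr_gt0.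
have /rnorm_cvgP/(_ _ e20) H1 := @contraction_cvg u.
have /cvgrPdist_lt/(_ _ e20) := @cauchy_seminorm_cvg _ _ _ _ (v - u).
have -> : limn (fun n => p ((v - u) n)) = 0 by exact: H.
apply: filterS2 H1 => n H1; rewrite sub0r normrN => H2.
rewrite (le_lt_trans (rnorm_triangle (f (u n)) _ _))// [ltRHS]splitr ltrD//.
rewrite rnorm_distC -raddfB (le_lt_trans (contractionP _ _))//.
exact: le_lt_trans (ler_norm _) H2.
Qed.

Fact completion_lift_linear : linear completion_lift.
Proof.
move=> a w w'; have [u ->] := sepquot_pi_surj w; have [v ->] := sepquot_pi_surj w'.
rewrite -linearP !completion_lift_pi; apply/cvg_lim => //.
have -> : (fun n => f ((a *: u + v) n)) = (fun n => a *: f (u n) + f (v n)).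
  by apply/funext => n; rewrite -linearP.
by apply: cvgD; [apply: cvgZr|]; exact: contraction_cvg.
Qed.

HB.instance Definition _ := GRing.isLinear.Build K (completion p) G _
  completion_lift completion_lift_linear.

Lemma completion_lift_in x : completion_lift (completion_in p x) = f x.
Proof. by rewrite completion_lift_pi; apply: lim_cst; [exact: norm_hausdorff|exact: eventually_filter]. Qed.

Lemma completion_lift_le w : rnorm (completion_lift w) <= rnorm w.
Proof.
have [u ->] := sepquot_pi_surj w; rewrite completion_lift_pi rnorm_sepquot_pi.
have H : p (u n) - rnorm (f (u n)) @[n --> \oo] -->
    cauchy_seminorm p u - rnorm (limn (fun n => f (u n))).
  apply: cvgB; first exact: cauchy_seminorm_cvg.
  by apply: cvg_rnorm; exact: contraction_cvg.
rewrite -subr_ge0 -(cvg_lim _ H)//; apply: limr_ge; first by apply/cvg_ex; eexists; exact: H.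
by apply: nearW => n; rewrite /= subr_ge0 contractionP.
Qed.

Lemma completion_lift_unique (g : {linear completion p -> G}) :
  (forall w, rnorm (g w) <= rnorm w) ->
  (forall x, g (completion_in p x) = f x) -> g =1 completion_lift.
Proof.
move=> gle gf w; apply/eqP; rewrite -subr_eq0; apply/eqP/rnorm_eq0.
apply/eqP; rewrite eq_le rnorm_ge0 andbT; apply/ler_addgt0Pl => e e0.
rewrite addr0; have e20 : 0 < e / 2 by rewrite divr_gt0.
have [x wx] := completion_in_dense w e20.
rewrite (le_trans (rnorm_triangle (f x) _ _))// [leRHS]splitr lerD//.
  by rewrite -gf -raddfB (le_trans (gle _))// ltW.
rewrite -completion_lift_in -raddfB (le_trans (completion_lift_le _))//.
by rewrite rnorm_distC ltW.
Qed.

End completion_lift.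

Section ptensor_lift.
Variables (R : realType) (k : scalar_kind) (E F : completeNormedModType (scalar_field R k)).
Variables (G : completeNormedModType (scalar_field R k)) (f : {bilinear E -> F -> G}).
Hypothesis fle : forall x y, rnorm (f x y) <= rnorm x * rnorm y.

Fact tensor_lift_le u : rnorm (tensor_lift f u) <= proj_seminorm E F u.
Proof.
apply: le_proj_norm => s ->; rewrite raddf_sum /proj_cost.
apply: (big_ind2 (fun x r => rnorm x <= r)) => [|x x' y y' xx' yy'|]; first by rewrite rnorm0.
  exact: le_trans (rnormD _ _) (lerD xx' yy').
by move=> xy _; rewrite /= tensor_lift_tens fle.
Qed.

Definition tensor_contraction : contraction (proj_seminorm E F) G :=
  Contraction tensor_lift_le.

Definition ptensor_lift : {linear ptensor E F -> G} :=
  completion_lift tensor_contraction.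

Lemma ptensor_lift_ptens x y : ptensor_lift (ptens x y) = f x y.
Proof. by rewrite /= completion_lift_in /= tensor_lift_tens. Qed.

Lemma ptensor_lift_le w : rnorm (ptensor_lift w) <= rnorm w.
Proof. exact: completion_lift_le. Qed.

Lemma ptensor_lift_unique (g : {linear ptensor E F -> G}) :
  (forall w, rnorm (g w) <= rnorm w) ->
  (forall x y, g (ptens x y) = f x y) -> g =1 ptensor_lift.
Proof.
move=> gle gf; apply: completion_lift_unique => // u.
have [s ->] := tensor_sum u; rewrite !raddf_sum; apply: eq_bigr => xy _ /=.
by rewrite tensor_lift_tens -gf.
Qed.

End ptensor_lift.

Section psi0.
Variables (R : realType) (k : scalar_kind) (I : Type) (U : set_system I).
Variables (UU : UltraFilter U) (E F : completeNormedModType (scalar_field R k)).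
Local Notation K := (scalar_field R k).

Fact linfty_ptens_bounded (f : linfty_type I E) (g : linfty_type I F) :
  (fun i => ptens (f i) (g i)) \in @linfty R k I (ptensor E F).
Proof.
have [M M0 fM] := linfty_bounded f; have [N N0 gN] := linfty_bounded g.
apply/asboolP; exists (M * N) => i; rewrite (le_trans (rnorm_ptens_le _ _))//.
by rewrite ler_pM ?rnorm_ge0.
Qed.

Definition linfty_ptens (f : linfty_type I E) (g : linfty_type I F) :
  linfty_type I (ptensor E F) := Linfty (linfty_ptens_bounded f g).

Fact linfty_ptens_is_bilinear : bilinear_for *:%R *:%R linfty_ptens.
Proof.
split=> [g|f] a h h'; apply: val_inj; apply/funext => i /=.
  exact: (linearPl (@ptens R k E F)).
exact: (linearPr (@ptens R k E F)).
Qed.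

HB.instance Definition _ := bilinear_isBilinear.Build K (linfty_type I E)
  (linfty_type I F) (linfty_type I (ptensor E F)) *:%R *:%R linfty_ptens
  linfty_ptens_is_bilinear.

Lemma ultra_seminorm_ptens_le f g :
  ultra_seminorm UU (ptensor E F) (linfty_ptens f g) <=
  ultra_seminorm UU E f * ultra_seminorm UU F g.
Proof.
have H : rnorm (f i) * rnorm (g i) - rnorm (ptens (f i) (g i)) @[i --> U] -->
    ultra_seminorm UU E f * ultra_seminorm UU F g
    - ultra_seminorm UU (ptensor E F) (linfty_ptens f g).
  apply: cvgB; last exact: (@linfty_cvg R k I U UU _ (linfty_ptens f g)).
  by apply: cvgM; exact: linfty_cvg.
rewrite -subr_ge0 -(cvg_lim _ H)//; apply: limr_ge; first by apply/cvg_ex; eexists; exact: H.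
by apply: nearW => n; rewrite /= subr_ge0 rnorm_ptens_le.
Qed.

Definition ultra_ptens (u : ultrapower UU E) (v : ultrapower UU F) :
    ultrapower UU (ptensor E F) :=
  ultra_pi UU _ (linfty_ptens (repr u) (repr v)).

Lemma ultra_ptens_pi f g :
  ultra_ptens (ultra_pi UU E f) (ultra_pi UU F g) =
  ultra_pi UU (ptensor E F) (linfty_ptens f g).
Proof.
rewrite /ultra_ptens; set f' := repr _; set g' := repr _.
have Hf : ultra_seminorm UU E (f' - f) = 0 by apply/sepquot_piP/sepquot_piK.
have Hg : ultra_seminorm UU F (g' - g) = 0 by apply/sepquot_piP/sepquot_piK.
apply/sepquot_piP.
have -> : linfty_ptens f' g' - linfty_ptens f g =
    linfty_ptens (f' - f) g' + linfty_ptens f (g' - g).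
  by rewrite linearBl linearBr addrA subrK.
apply/eqP; rewrite eq_le seminorm_ge0 andbT (le_trans (seminormD _ _ _))//.
rewrite (le_trans (lerD (ultra_seminorm_ptens_le _ _) (ultra_seminorm_ptens_le _ _)))//.
by rewrite Hf Hg mul0r mulr0 addr0.
Qed.

Fact ultra_ptens_is_bilinear : bilinear_for *:%R *:%R ultra_ptens.
Proof.
split=> [v|u] a w w'.
  have [g ->] := ultra_pi_surj v; have [f ->] := ultra_pi_surj w.
  have [f' ->] := ultra_pi_surj w'; rewrite -linearP !ultra_ptens_pi -linearP.
  by rewrite (linearPl linfty_ptens).
have [g ->] := ultra_pi_surj u; have [f ->] := ultra_pi_surj w.
have [f' ->] := ultra_pi_surj w'; rewrite -linearP !ultra_ptens_pi -linearP.
by rewrite (linearPr linfty_ptens).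
Qed.

HB.instance Definition _ := bilinear_isBilinear.Build K (ultrapower UU E)
  (ultrapower UU F) (ultrapower UU (ptensor E F)) *:%R *:%R ultra_ptens
  ultra_ptens_is_bilinear.

Fact ultra_ptens_le u v : rnorm (ultra_ptens u v) <= rnorm u * rnorm v.
Proof.
have [f ->] := ultra_pi_surj u; have [g ->] := ultra_pi_surj v.
rewrite ultra_ptens_pi !rnorm_ultra_pi -!ultra_seminormE.
exact: ultra_seminorm_ptens_le.
Qed.

Definition psi0 :
    {linear ptensor (ultrapower UU E) (ultrapower UU F) ->
            ultrapower UU (ptensor E F)} :=
  ptensor_lift ultra_ptens_le.

Lemma psi0_ptens f g :
  psi0 (ptens (ultra_pi UU E f) (ultra_pi UU F g)) =
  ultra_pi UU (ptensor E F) (linfty_ptens f g).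
Proof. by rewrite ptensor_lift_ptens; exact: ultra_ptens_pi. Qed.

Lemma psi0_le w : rnorm (psi0 w) <= rnorm w.
Proof. exact: ptensor_lift_le. Qed.

Lemma psi0_unique
    (g : {linear ptensor (ultrapower UU E) (ultrapower UU F) ->
                 ultrapower UU (ptensor E F)}) :
  (forall w, rnorm (g w) <= rnorm w) ->
  (forall f h, g (ptens (ultra_pi UU E f) (ultra_pi UU F h)) =
               ultra_pi UU (ptensor E F) (linfty_ptens f h)) ->
  g =1 psi0.
Proof.
move=> gle gE; apply: ptensor_lift_unique => // u v.
have [f ->] := ultra_pi_surj u; have [h ->] := ultra_pi_surj v.
by rewrite gE; symmetry; exact: ultra_ptens_pi.
Qed.

End psi0.

Definition countably_incomplete (I : Type) (U : set_system I) : Prop :=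
  exists A : nat -> set I,
    [/\ forall n, U (A n), forall n, A n.+1 `<=` A n & \bigcap_n A n = set0].

(* hdot is linear in its first argument. *)
Record hilbertType (R : realType) (k : scalar_kind) := HilbertSpace {
  hilbert_sort :> completeNormedModType (scalar_field R k);
  hdot : {dot hilbert_sort for @conj_scalar R k};
  hdot_norm : forall x : hilbert_sort, `|x| ^+ 2 = hdot x x }.

Definition infinite_dimensional (K : fieldType) (V : lmodType K) : Prop :=
  ~ exists (n : nat) (e : 'I_n -> V),
      forall x, exists c : 'I_n -> K, x = \sum_(i < n) c i *: e i.

(* Main.v *)
(* Let t_i be the average of the e_j (x) f_j over j < n_i, for orthonormal families
   e of H and f of K, where n_i tends to infinity along U; such n_i exist because U is
   countably incomplete.  An element of the range of psi_0 is close to the image of a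
   finite sum of m elementary tensors, hence is represented by a family of tensors of
   rank at most m.  If s has rank at most m and Q is the orthogonal projection onto a
   space of dimension at most m containing the left factors of s, the bilinear form
   B(x, y) = sum_j <x - Q x, e_j> <y, f_j>, of norm at most 1, vanishes on s, whereas
   B(t_i) >= 1 - m / n_i by Bessel's inequality.  So (t_i) is at distance at least 1
   from the range. *)
Require Import Defs.
From HB Require Import structures.
From mathcomp Require Import all_boot all_order all_algebra.
From mathcomp Require Import all_classical all_reals all_analysis.
From mathcomp Require Import complex ring lra.
Set Implicit Arguments.
Unset Strict Implicit.
Unset Printing Implicit Defensive.
Import Order.TTheory GRing.Theory Num.Theory.
Import numFieldNormedType.Exports.
Local Open Scope classical_set_scope.
Local Open Scope ring_scope.

(** * Finite Cauchy-Schwarz inequality and scalar conjugation *)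

Lemma ler_sum_mul (K : numFieldType) (n : nat) (a b : 'I_n -> K) (A B : K) :
  (forall i, 0 <= a i) -> (forall i, 0 <= b i) -> 0 <= A -> 0 <= B ->
  \sum_i a i ^+ 2 <= A ^+ 2 -> \sum_i b i ^+ 2 <= B ^+ 2 ->
  \sum_i a i * b i <= A * B.
Proof.
move=> a0 b0 A0 B0 aA bB.
have ab0 : 0 <= \sum_i a i * b i by apply: sumr_ge0 => i _; rewrite mulr_ge0.
rewrite -ler_sqr ?nnegrE ?mulr_ge0// exprMn.
have a20 : 0 <= \sum_i a i ^+ 2 by apply: sumr_ge0 => i _; rewrite exprn_ge0.
have b20 : 0 <= \sum_i b i ^+ 2 by apply: sumr_ge0 => i _; rewrite exprn_ge0.
apply: le_trans (ler_pM a20 b20 aA bB).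
(* Lagrange's identity: this double sum of squares is twice the defect in the squared inequality. *)
have H : 0 <= \sum_i \sum_j (a i * b j - a j * b i) ^+ 2.
  apply: sumr_ge0 => i _; apply: sumr_ge0 => j _.
  by rewrite real_exprn_even_ge0// rpredB// realM ?ger0_real.
have E : \sum_i \sum_j (a i * b j - a j * b i) ^+ 2 =
    2 * ((\sum_i a i ^+ 2) * (\sum_i b i ^+ 2) - (\sum_i a i * b i) ^+ 2).
  have -> : 2 * ((\sum_i a i ^+ 2) * (\sum_i b i ^+ 2) - (\sum_i a i * b i) ^+ 2) =
      (\sum_i a i ^+ 2) * (\sum_i b i ^+ 2) + (\sum_i b i ^+ 2) * (\sum_i a i ^+ 2)
      - 2 * ((\sum_i a i * b i) * (\sum_i a i * b i)) by ring.
  rewrite !big_distrlr /= mulr_sumr -big_split -sumrB /=; apply: eq_bigr => i _.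
  rewrite mulr_sumr -big_split -sumrB /=; apply: eq_bigr => j _; ring.
by move: H; rewrite E pmulr_rge0 ?ltr0n// subr_ge0.
Qed.

Section scalars.
Variables (R : realType) (k : scalar_kind).
Local Notation K := (scalar_field R k).
Local Notation cj := (@conj_scalar R k).

Fact conj_scalar_zmod : zmod_morphism cj.
Proof. by case: k => a b //=; exact: rmorphB. Qed.

Fact conj_scalar_monoid : monoid_morphism cj.
Proof. case: k; split=> [|a b] //=; [exact: conjc1|exact: rmorphM]. Qed.

HB.instance Definition _ := GRing.isZmodMorphism.Build K K cj conj_scalar_zmod.
HB.instance Definition _ := GRing.isMonoidMorphism.Build K K cj conj_scalar_monoid.

Lemma mul_conj_scalar (a : K) : a * cj a = `|a| ^+ 2.
Proof.
move: a; case: k => /= a; last by rewrite normCK.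
by rewrite real_normK ?num_real.
Qed.

Lemma of_real_nat n : of_real k (n%:R : R) = n%:R.
Proof. by elim: n => [|n IH]; rewrite ?of_real0// -!natr1 of_realD IH of_real1. Qed.

Lemma of_real_natB m n : of_real k (n%:R - m%:R : R) = n%:R - m%:R.
Proof.
by apply: (addIr m%:R); rewrite subrK -(of_real_nat m) -of_realD subrK of_real_nat.
Qed.

End scalars.

(** * Orthonormal families: projections, Bessel, Gram-Schmidt *)

Section orthonormal.
Variables (R : realType) (k : scalar_kind) (H : hilbertType R k).
Local Notation K := (scalar_field R k).
Local Notation "<[ x , y ]>" := (hdot H x y).
Implicit Types (x y : H) (e : nat -> H).

Lemma hdotC x y : <[x, y]> = conj_scalar <[y, x]>.
Proof. by rewrite (hermC (hdot H)) expr0 mul1r. Qed.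

Lemma hdot_sumZl n (c : 'I_n -> K) (v : 'I_n -> H) y :
  <[\sum_(i < n) c i *: v i, y]> = \sum_(i < n) c i * <[v i, y]>.
Proof. by rewrite linear_sumlz; apply: eq_bigr => i _; rewrite linearZl_LR. Qed.

(** Families are indexed by [nat] and constrained only below [n], so they can be extended without a
    change of type. *)
Definition orthonormal_family n e := forall i j, (i < n)%N -> (j < n)%N ->
  <[e i, e j]> = (i == j)%:R.

Definition proj n e x : H := \sum_(i < n) <[x, e i]> *: e i.

Lemma proj_linear n e : linear (proj n e).
Proof.
move=> a x y; rewrite /proj scaler_sumr -big_split; apply: eq_bigr => i _ /=.
by rewrite linearPl /= scalerDl scalerA.
Qed.

Lemma proj_hdotl n e x y : <[proj n e x, y]> = \sum_(i < n) <[x, e i]> * <[e i, y]>.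
Proof. exact: hdot_sumZl. Qed.

Lemma hdot_proj_basis n e x i : orthonormal_family n e -> (i < n)%N ->
  <[x - proj n e x, e i]> = 0.
Proof.
move=> oe ni; rewrite linearBl /= proj_hdotl (bigD1 (Ordinal ni))//= oe// eqxx mulr1.
rewrite big1 ?addr0 ?subrr// => j ji; rewrite oe//.
by rewrite (_ : (j : nat) == i = false) ?mulr0//; apply/negbTE.
Qed.

Lemma hdot_perp n e x y : (forall i, (i < n)%N -> <[x, e i]> = 0) -> <[x, proj n e y]> = 0.
Proof.
move=> xe; rewrite hdotC proj_hdotl big1 ?rmorph0// => i _.
by rewrite (hdotC (e i)) xe// rmorph0 mulr0.
Qed.

Lemma hdot_perp_proj n e x : orthonormal_family n e ->
  <[x - proj n e x, x]> = `|x - proj n e x| ^+ 2.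
Proof.
move=> oe; have vp : <[x - proj n e x, proj n e x]> = 0.
  by apply: hdot_perp => i ni; exact: hdot_proj_basis.
by rewrite hdot_norm [RHS]linearBr /= vp subr0.
Qed.

Lemma pythagoras n e x : orthonormal_family n e ->
  `|x - proj n e x| ^+ 2 = `|x| ^+ 2 - \sum_(i < n) `|<[x, e i]>| ^+ 2.
Proof.
move=> oe; rewrite -hdot_perp_proj// linearBl /= hdot_norm proj_hdotl; congr (_ - _).
by apply: eq_bigr => i _; rewrite (hdotC (e i)) mul_conj_scalar.
Qed.

Lemma bessel n e x : orthonormal_family n e ->
  \sum_(i < n) `|<[x, e i]>| ^+ 2 <= `|x| ^+ 2.
Proof. by move=> oe; rewrite -subr_ge0 -pythagoras// exprn_ge0. Qed.

Lemma norm_perp_le n e x : orthonormal_family n e -> `|x - proj n e x| <= `|x|.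
Proof.
move=> oe; rewrite -ler_sqr ?nnegrE// pythagoras// gerBl.
by apply: sumr_ge0 => i _; rewrite exprn_ge0.
Qed.

(** One Gram-Schmidt step: the new vector is the normalised residue of [x]. The last clause keeps
    earlier vectors in the span. *)
Lemma orthonormal_extend n e x : orthonormal_family n e -> proj n e x <> x ->
  exists e', [/\ orthonormal_family n.+1 e', proj n.+1 e' x = x &
    forall y, proj n e y = y -> proj n.+1 e' y = y].
Proof.
move=> oe xe; pose v := x - proj n e x; pose z := `|v|^-1 *: v.
have v0 : `|v| != 0 by rewrite normr_eq0 subr_eq0; apply/eqP => xE; apply: xe.
have ve i : (i < n)%N -> <[v, e i]> = 0 by move=> ni; exact: hdot_proj_basis.
have ze i : (i < n)%N -> <[z, e i]> = 0.
  by move=> ni; rewrite linearZl_LR /= ve// mulr0.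
have ez i : (i < n)%N -> <[e i, z]> = 0 by move=> ni; rewrite hdotC ze// rmorph0.
(* Cancel [a = |v|^-1] in [a * conj_scalar a = |a|^2], where [|a| = a]. *)
have cjv : conj_scalar `|v|^-1 = `|v|^-1 :> K.
  have := mul_conj_scalar (`|v|^-1 : K); rewrite expr2 normfV normr_id.
  by apply: mulfI; rewrite invr_eq0.
have hz y : <[y, z]> = `|v|^-1 * <[y, v]>.
  by rewrite hdotC linearZl_LR /= rmorphM /= cjv -hdotC.
have zz : <[z, z]> = 1.
  by rewrite hz linearZl_LR /= -hdot_norm expr2 mulrA mulrACA mulVf// mulr1.
pose e' i := if (i == n) then z else e i.
have e'e i : (i < n)%N -> e' i = e i by move=> ni; rewrite /e' ltn_eqF.
have e'n : e' n = z by rewrite /e' eqxx.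
have pS y : proj n.+1 e' y = proj n e y + <[y, z]> *: z.
  rewrite /proj big_ord_recr /= e'n; congr (_ + _).
  by apply: eq_bigr => i _; rewrite e'e.
exists e'; split.
- move=> i j; rewrite ltnS leq_eqVlt => /predU1P[->|ni];
    rewrite ltnS leq_eqVlt => /predU1P[->|nj].
  + by rewrite e'n zz eqxx.
  + by rewrite e'n e'e// ze// gtn_eqF.
  + by rewrite e'n e'e// ez// ltn_eqF.
  + by rewrite !e'e// oe.
- have xv : <[x, v]> = `|v| ^+ 2 by rewrite hdotC hdot_perp_proj// hdot_norm -hdotC.
  rewrite pS hz xv scalerA expr2 mulrA mulVf// mul1r mulfV// scale1r.
  by rewrite addrC subrK.
- by move=> y yE; rewrite pS yE hdotC -yE hdot_perp// rmorph0 scale0r addr0.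
Qed.

(** Vectors already in the span are skipped, so [m] is only bounded by [size s]. *)
Lemma gram_schmidt (s : seq H) : exists m e,
  [/\ (m <= size s)%N, orthonormal_family m e & forall x, x \in s -> proj m e x = x].
Proof.
elim: s => [|x s [m [e [ms oe se]]]]; first by exists 0%N, (fun=> 0); split.
have [xe|xe] := eqVneq (proj m e x) x.
  exists m, e; split=> //; first exact: leqW.
  by move=> y; rewrite inE => /predU1P[->|/se].
have [e' [oe' xe' ee']] := orthonormal_extend oe (elimN eqP xe).
exists m.+1, e'; split=> // y; rewrite inE => /predU1P[->//|/se]; exact: ee'.
Qed.

(** If the projection fixed every vector, the family would span [H]. *)
Lemma infinite_orthonormal n : infinite_dimensional H ->
  exists e, orthonormal_family n e.
Proof.
move=> Hinf; elim: n => [|n [e oe]]; first by exists (fun=> 0).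
have [x xe] : exists x, proj n e x <> x.
  apply: contrapT => nx; apply: Hinf; exists n, (fun i => e i) => x.
  exists (fun i => <[x, e i]>); apply/esym; apply: contrapT => xe; apply: nx; by exists x.
by have [e' [oe' _ _]] := orthonormal_extend oe xe; exists e'.
Qed.

End orthonormal.

(** * The bilinear form separating diagonal tensors from low rank *)

Section test_form.
Variables (R : realType) (k : scalar_kind) (H K : hilbertType R k).
Local Notation F := (scalar_field R k).
Variables (m n : nat) (g e : nat -> H) (f : nat -> K).

(** The form B, with Q = [proj m g]. Both variables stand in the first slot of [hdot], so B is
    bilinear over complex scalars too. *)
Definition test_form (x : H) (y : K) : F^o :=
  \sum_(i < n) hdot H (x - proj m g x) (e i) * hdot K y (f i).

Fact test_form_is_bilinear : bilinear_for *:%R *:%R test_form.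
Proof.
split=> [y|x] a z z'; rewrite /test_form /= scaler_sumr -big_split /=;
    apply: eq_bigr => i _.
  have -> : a *: z + z' - proj m g (a *: z + z') =
      a *: (z - proj m g z) + (z' - proj m g z').
    by rewrite proj_linear scalerBr opprD addrACA.
  by rewrite linearPl /= mulrDl -mulrA.
by rewrite linearPl /= mulrDr mulrCA.
Qed.

HB.instance Definition _ := bilinear_isBilinear.Build F H K F^o *:%R *:%R test_form
  test_form_is_bilinear.

Hypotheses (og : orthonormal_family m g) (oe : orthonormal_family n e)
  (orf : orthonormal_family n f).

(** Cauchy-Schwarz for the two coefficient families, each controlled by Bessel; removing a
    projection does not increase the norm. *)
Lemma test_form_le x y : rabs (test_form x y : F) <= rnorm x * rnorm y.
Proof.
rewrite -(ler_of_real k) of_realM of_real_rabs !of_real_rnorm.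
apply: le_trans (ler_norm_sum _ _ _) _.
under eq_bigr do rewrite normrM.
apply: ler_sum_mul => //; last exact: bessel.
apply: le_trans (bessel _ oe) _; rewrite ler_sqr ?nnegrE//; exact: norm_perp_le.
Qed.

(** B is bounded by the cost of every representation of [u], hence by their infimum; its values thus
    bound [proj_norm] from below. *)
Lemma rabs_test_form_lift u :
  rabs (tensor_lift test_form u : F) <= proj_norm u.
Proof.
apply: le_proj_norm => s ->; rewrite raddf_sum /proj_cost /=.
have rE z : rabs z = rnorm (z : F^o) by [].
rewrite rE; apply: (big_ind2 (fun x r => rnorm (x : F^o) <= r)) => [|x x' y y' xx' yy'|].
- by rewrite rnorm0.
- exact: le_trans (rnormD _ _) (lerD xx' yy').
- by move=> xy _; rewrite /= tensor_lift_tens -rE test_form_le.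
Qed.

(** The total loss is a double sum over [g] and [e]; after exchanging the sums, Bessel for [e]
    bounds the share of each unit vector [g j] by 1. *)
Lemma test_form_diagonal :
  n%:R - m%:R <= tensor_lift test_form (\sum_(i < n) tens (e i) (f i)) :> F.
Proof.
rewrite raddf_sum /=.
have -> : \sum_(i < n) tensor_lift test_form (tens (e i) (f i)) =
    \sum_(i < n) (1 - \sum_(j < m) `|hdot H (g j) (e i)| ^+ 2).
  apply: eq_bigr => i _; rewrite tensor_lift_tens.
  rewrite -[LHS]/(\sum_(j < n) hdot H (e i - proj m g (e i)) (e j) * hdot K (f i) (f j) : F).
  rewrite (bigD1 i)//= big1 => [|j ji].
    rewrite addr0 orf// eqxx mulr1 linearBl /= oe// eqxx proj_hdotl; congr (_ - _).
    by apply: eq_bigr => j _; rewrite (hdotC (e i)) mulrC mul_conj_scalar.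
  rewrite orf// (_ : (i : nat) == j = false) ?mulr0//.
  by rewrite eq_sym; apply/negbTE.
rewrite sumrB sumr_const card_ord lerD2l lerN2 exchange_big /=.
have -> : m%:R = \sum_(j < m) (1 : F) by rewrite sumr_const card_ord.
apply: ler_sum => j _; apply: le_trans (bessel _ oe) _.
by rewrite hdot_norm og// eqxx.
Qed.

End test_form.

(** * Distance from diagonal tensors to tensors of low rank *)

Section low_rank.
Variables (R : realType) (k : scalar_kind) (H K : hilbertType R k).
Local Notation F := (scalar_field R k).

Lemma diagonal_far_from_low_rank n (e : nat -> H) (f : nat -> K) (s : seq (H * K)) :
  orthonormal_family n e -> orthonormal_family n f ->
  n%:R - (size s)%:R <=
  proj_norm (\sum_(i < n) tens (e i) (f i) - \sum_(xy <- s) tens xy.1 xy.2) :> R.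
Proof.
move=> oe orf.
have [m [g [ms og gs]]] := gram_schmidt (unzip1 s).
rewrite size_map in ms.
apply: le_trans (rabs_test_form_lift og oe orf _).
(* The projection onto the span of [g] fixes all left factors of [s]. *)
have B0 : tensor_lift (test_form m n g e f) (\sum_(xy <- s) tens xy.1 xy.2) = 0.
  rewrite raddf_sum big_seq big1 // => xy xys /=.
  rewrite tensor_lift_tens; apply: big1 => i _.
  by rewrite gs ?map_f// subrr linear0l mul0r.
rewrite raddfB /= B0 subr0 -(ler_of_real k) of_real_rabs.
have nm : of_real k (n%:R - (size s)%:R) <= n%:R - m%:R :> F.
  by rewrite of_real_natB lerD2l lerN2 ler_nat.
have diag := test_form_diagonal og oe orf.
apply: (le_trans nm); apply: (le_trans diag).
(* The value of B is real, being comparable with the real number [n - m]. *)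
by apply: real_ler_norm; rewrite -(ler_real diag) rpredB ?realn.
Qed.

Lemma diagonal_norm_le n (e : nat -> H) (f : nat -> K) :
  orthonormal_family n e -> orthonormal_family n f ->
  proj_norm (\sum_(i < n) tens (e i) (f i)) <= n%:R :> R.
Proof.
move=> oe orf.
have n1 (V : hilbertType R k) (v : nat -> V) i :
    orthonormal_family n v -> (i < n)%N -> rnorm (v i) = 1.
  move=> ov ni; apply: (@of_real_inj _ k); rewrite of_real_rnorm of_real1.
  by apply/eqP; rewrite -(eqrXn2 (n := 2))// hdot_norm ov// eqxx expr1n.
have -> : n%:R = \sum_(i < n) (1 : R) by rewrite sumr_const card_ord.
apply: (big_ind2 (fun x r => proj_norm x <= r)) => [|x x' y y' xx' yy'|i _].
- by have := proj_norm_le ([::] : seq (H * K)); rewrite /proj_cost !big_nil.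
- exact: le_trans (proj_normD _ _) (lerD xx' yy').
- have := proj_norm_le [:: (e i, f i)].
  by rewrite /proj_cost !big_seq1 /= !n1// mulr1.
Qed.

Lemma far_from_low_rank n : infinite_dimensional H -> infinite_dimensional K ->
  exists2 t : tensor H K, proj_norm t <= 1 & forall s : seq (H * K),
    1 - (size s)%:R / n.+1%:R <= proj_norm (t - \sum_(xy <- s) tens xy.1 xy.2).
Proof.
move=> Hinf Kinf.
have [e oe] := infinite_orthonormal n.+1 Hinf.
have [f orf] := infinite_orthonormal n.+1 Kinf.
set N : R := n.+1%:R; have N0 : 0 < N by rewrite ltr0n.
have cN : rabs (of_real k N^-1) = N^-1.
  by rewrite /rabs of_real_normr of_realK ger0_norm// invr_ge0 ltW.
exists (of_real k N^-1 *: \sum_(i < n.+1) tens (e i) (f i)) => [|s].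
  by rewrite proj_normZ cN mulrC ler_pdivrMr// mul1r; exact: diagonal_norm_le.
(* Rescaling the left factors keeps the number of terms, so the bound for the unnormalised diagonal
   applies. *)
have sE : \sum_(xy <- s) tens xy.1 xy.2 = of_real k N^-1 *:
    \sum_(xy <- tensor_scale_seq (of_real k N) s) tens xy.1 xy.2.
  rewrite big_map scaler_sumr; apply: eq_bigr => xy _ /=.
  by rewrite linearZl_LR scalerA -of_realM mulVf ?gt_eqF// of_real1 scale1r.
rewrite sE -scalerBr proj_normZ cN ler_pdivlMl// mulrBr mulr1 mulrC divfK ?gt_eqF//.
have := diagonal_far_from_low_rank (tensor_scale_seq (of_real k N) s) oe orf.
by rewrite size_map.
Qed.

End low_rank.

(** Take [n i] with [i] outside [A (n i)]; as the sets decrease, [i] in [A N] forces [N < n i]. *)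
Lemma countably_incomplete_index (I : Type) (U : set_system I) :
  Filter U -> countably_incomplete U ->
  exists n : I -> nat, forall N, \forall i \near U, (N < n i)%N.
Proof.
move=> FU [A [UA Adecr A0]].
have /choice[n nA] : forall i, exists n, ~ A n i.
  move=> i; apply: contrapT => nA.
  have : (\bigcap_n A n) i by move=> m _; apply: contrapT => Am; apply: nA; exists m.
  by rewrite A0.
exists n => N; apply: filterS (UA N) => i AN; rewrite ltnNge; apply/negP => nN.
apply: (nA i); elim: N nN AN {UA} => [|N IH]; first by rewrite leqn0 => /eqP ->.
by rewrite leq_eqVlt => /predU1P[->//|/IH{}IH /Adecr].
Qed.

Lemma half_le_compl_ratio (R : realFieldType) (m n : nat) : (2 * m < n)%N ->
  2^-1 <= 1 - m%:R / n.+1%:R :> R.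
Proof.
move=> mn; rewrite lerBrDr -lerBrDl ler_pdivrMr ?ltr0n//.
have : (2 * m)%:R <= n.+1%:R :> R by rewrite ler_nat ltnW// ltnW.
rewrite natrM; lra.
Qed.

(** * Approximating the range by families of bounded rank *)

Section psi0_range.
Variables (R : realType) (k : scalar_kind) (I : Type) (U : set_system I).
Variables (UU : UltraFilter U) (E F : completeNormedModType (scalar_field R k)).

(** Choosing representatives of all factors gives, at each index, a sum with as many terms as [s]:
    the rank bound is uniform in [i]. *)
Lemma psi0_tensor_sum (s : seq (ultrapower UU E * ultrapower UU F)) :
  exists2 h : linfty_type I (ptensor E F),
    psi0 UU E F (completion_in _ (\sum_(xy <- s) tens xy.1 xy.2)) = ultra_pi UU _ h &
    forall i, exists2 r : seq (E * F), size r = size s &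
      h i = completion_in _ (\sum_(xy <- r) tens xy.1 xy.2).
Proof.
pose h := \sum_(xy <- s) linfty_ptens (repr xy.1) (repr xy.2).
exists h => [|i].
  rewrite !raddf_sum; apply: eq_bigr => xy _; exact: ptensor_lift_ptens.
exists [seq ((repr xy.1 : linfty_type I E) i, (repr xy.2 : linfty_type I F) i) | xy <- s]; first by rewrite size_map.
rewrite big_map raddf_sum /h.
by elim/big_ind2: _ => // a b c d <- <-.
Qed.

(** Finite sums are dense in the completion and [psi0] is norm-decreasing. *)
Lemma psi0_dense_range (w : ptensor (ultrapower UU E) (ultrapower UU F)) (e : R) : 0 < e ->
  exists s : seq (ultrapower UU E * ultrapower UU F),
    rnorm (psi0 UU E F w -
      psi0 UU E F (completion_in _ (\sum_(xy <- s) tens xy.1 xy.2))) < e.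
Proof.
move=> e0; have [u wu] := completion_in_dense w e0.
have [s us] := tensor_sum u; exists s.
by rewrite -us -raddfB (le_lt_trans (psi0_le _)).
Qed.

End psi0_range.

Theorem theorem4p6 (R : realType) (k : scalar_kind) (H K : hilbertType R k)
    (I : Type) (U : set_system I) (UU : UltraFilter U) :
  infinite_dimensional H -> infinite_dimensional K ->
  countably_incomplete U ->
  ~ dense (range (psi0 UU H K)).
Proof.
move=> Hinf Kinf Uinc Hdense.
have [n nU] := countably_incomplete_index _ Uinc.
have /choice[t ht] : forall m, exists t : tensor H K, proj_norm t <= 1 /\
    forall s : seq (H * K),
      1 - (size s)%:R / m.+1%:R <= proj_norm (t - \sum_(xy <- s) tens xy.1 xy.2).
  by move=> m; have [x] := far_from_low_rank m Hinf Kinf; exists x.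
have tl : (fun i => completion_in (proj_seminorm H K) (t (n i)))
    \in @linfty R k I (ptensor H K).
  by apply/asboolP; exists 1 => i; rewrite rnorm_completion_in; have [] := ht (n i).
set tau := ultra_pi UU (ptensor H K) (Linfty tl).
(* A gap of 1/2 is enough: one quarter for approaching [tau] from the range, one for passing to a
   finite sum. *)
have e0 : 0 < 4^-1 :> R by rewrite invr_gt0.
have e0K : 0 < of_real k (4^-1 : R) by rewrite -(of_real0 R k) ltr_of_real.
have [z [zball [w _ wz]]] : (ball tau (of_real k (4^-1 : R)) `&` range (psi0 UU H K)) !=set0.
  apply: Hdense; last exact: ball_open.
  by exists tau; exact: ballxx.
move: zball; rewrite -wz -ball_normE /= -of_real_rnorm ltr_of_real => tauw.
have [s ws] := psi0_dense_range w e0.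
have [h hE hr] := psi0_tensor_sum s.
have : rnorm (tau - ultra_pi UU _ h) < 2^-1.
  have -> : 2^-1 = 4^-1 + 4^-1 :> R by field.
  rewrite -hE; exact: le_lt_trans (rnorm_triangle _ _ _) (ltrD tauw ws).
apply/negP; rewrite -leNgt -raddfB rnorm_ultra_pi.
apply: limr_ge; first exact: linfty_cvg.
(* For [U]-almost all [i] the rank is below half of [n i], so the norm at [i] is at least 1/2, and
   so is the limit. *)
apply: filterS (nU (2 * size s)%N) => i ni.
have [r rs hi] := hr i.
rewrite [X in rnorm X](_ : _ = completion_in (proj_seminorm H K) (t (n i)) - h i)//.
rewrite hi -raddfB rnorm_completion_in; apply: le_trans ((ht (n i)).2 r).
by rewrite rs; exact: half_le_compl_ratio.
Qed.
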